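(* Let $\Gamma$ be a countable amenable group, and let $(X,T)$ be a $\Gamma$-dynamical system. Then $$\mathrm{mdim}(X,T)\le \dim(X,T).$$
   Context: A $\Gamma$-dynamical system $(X,T)$ is a compact metric space $X$ with a homomorphism $T$, $\gamma\mapsto T_\gamma$, from the countable discrete group $\Gamma$ to the group of self-homeomorphisms of $X$. $\mathrm{Prob}(X,T)$ is the set of $T$-invariant Borel probability measures on $X$. $\mathrm{Cov}(X)$ is the set of finite open covers of $X$; $\mathcal{V}\succeq\mathcal{U}$ means every $V\in\mathcal{V}$ is contained in some $U\in\mathcal{U}$; $\mathrm{ord}(\mathcal{V},x)=-1+\sum_{V\in\mathcal{V}}\mathbf{1}_V(x)$. The new dimension is $$\dim(X,T)=\sup_{\mathcal{U}\in\mathrm{Cov}(X)}\ \inf_{\mathcal{V}\in\mathrm{Cov}(X),\,\mathcal{V}\succeq\mathcal{U}}\ \sup_{\mu\in\mathrm{Prob}(X,T)}\int_X \mathrm{ord}(\mathcal{V},x)\,d\mu(x),$$ with $\dim(X,T)=-\infty$ if $\mathrm{Prob}(X,T)=\emptyset$. Gromov's mean dimension is $$\mathrm{mdim}(X,T)=\sup_{\mathcal{U}\in\mathrm{Cov}(X)}\ \lim_{n\to\infty}\frac{1}{|F_n|}\ \inf_{\mathcal{V}\in\mathrm{Cov}(X),\ \mathcal{V}\succeq\bigvee_{\gamma\in F_n}T_\gamma(\mathcal{U})}\ \sup_{x\in X}\mathrm{ord}(\mathcal{V},x),$$ where $T_\gamma(\mathcal{U})=\{T_\gamma(U):U\in\mathcal{U}\}$,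 $\bigvee_{\gamma\in F}T_\gamma(\mathcal{U})$ is the cover consisting of all sets $\bigcap_{\gamma\in F}T_\gamma(U_\gamma)$ with $U_\gamma\in\mathcal{U}$, and $(F_n)$ is a Følner sequence of $\Gamma$, i.e. nonempty finite subsets with $|F_n\gamma\,\triangle\,F_n|/|F_n|\to0$ for every $\gamma\in\Gamma$ (the limit exists and does not depend on the choice of the sequence, by the Ornstein–Weiss lemma). *)

(* Defs.v *)
From HB Require Import structures.
From mathcomp Require Import all_boot all_order all_algebra finmap.
From mathcomp Require Import all_classical all_reals all_analysis.

Set Implicit Arguments.
Unset Strict Implicit.
Unset Printing Implicit Defensive.
Import Order.TTheory GRing.Theory Num.Theory.
Import numFieldNormedType.Exports.

Local Open Scope classical_set_scope.
Local Open Scope ring_scope.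

(** * Amenability *)

Definition right_translate (G : groupType) (F : {fset G}) (g : G) : {fset G} :=
  [fset (x * g)%g | x in F]%fset.

Definition fsymdiff (K : choiceType) (A B : {fset K}) : {fset K} :=
  ((A `\` B) `|` (B `\` A))%fset.

Definition folner_ratio (R : realType) (G : groupType) (F : {fset G}) (g : G)
    : R :=
  #|` fsymdiff (right_translate F g) F|%:R / #|` F|%:R.

(* The Folner condition, with right translates as in folner_sequence. *)
Definition amenable (R : realType) (G : groupType) : Prop :=
  forall (K : {fset G}) (e : R), 0 < e ->
    exists2 F : {fset G}, F != fset0 &
      forall g, g \in K -> folner_ratio R F g <= e.

Definition folner_sequence (R : realType) (G : groupType) (F : nat -> {fset G})
    : Prop :=
  (forall n, F n != fset0) /\
  (forall g, (fun n => folner_ratio R (F n) g) @ \oo --> (0 : R)).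

(** * Dynamical systems *)

Definition homeomorphism (X : topologicalType) (f : X -> X) : Prop :=
  exists f' : X -> X,
    [/\ cancel f f', cancel f' f, continuous f & continuous f'].

Definition dynamical_system (R : realType) (G : groupType) (X : metricType R)
    (T : G -> X -> X) : Prop :=
  [/\ compact [set: X],
      forall g, homeomorphism (T g) &
      forall g h, T (g * h)%g = T g \o T h].

(** * Finite open covers *)

Definition Cov (X : topologicalType) : set (set (set X)) :=
  [set V | [/\ finite_set V, forall A, V A -> open A &
               \bigcup_(A in V) A = [set: X]]].
Arguments Cov : clear implicits.

Definition refines (X : Type) (V U : set (set X)) : Prop :=
  forall A, V A -> exists2 B, U B & A `<=` B.

(* Finitely supported sum over the members of V; for infinite V the value is
   meaningless, but only members of Cov are ever used. *)
Definition cover_ord (R : realType) (X : Type) (V : set (set X)) (x : X) : R :=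
  -1 + \sum_(A \in V) (\1_A x : R).

Definition joined_cover (G : groupType) (X : Type) (T : G -> X -> X)
    (F : {fset G}) (U : set (set X)) : set (set X) :=
  [set A | exists2 B : G -> set X, forall g, g \in F -> U (B g) &
           A = \bigcap_(g in [set` F]) (T g @` B g)].

(** * Invariant Borel probability measures *)

(* Types carrying a measure must be pointed in the library, whereas X may be
   empty. The Borel structure is therefore relative to a base point x0; it is
   the same for all x0, and an empty X has no probability measure. *)
Definition pointed_at (X : choiceType) (x0 : X) : Type := X.
HB.instance Definition _ (X : choiceType) (x0 : X) :=
  Choice.on (pointed_at x0).
HB.instance Definition _ (X : choiceType) (x0 : X) :=
  isPointed.Build (pointed_at x0) x0.

Definition borel (X : topologicalType) (x0 : X) :=
  g_sigma_algebraType (@open X : set (set (pointed_at x0))).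

Definition T_invariant (R : realType) (G : groupType) (X : topologicalType)
    (x0 : X) (T : G -> X -> X) (mu : probability (borel x0) R) : Prop :=
  forall (g : G) (A : set (borel x0)), measurable A -> mu (T g @^-1` A) = mu A.

(** * The two dimensions *)

(* Infima and suprema are taken in the extended reals, where the supremum of
   the empty set is -oo; hence dyn_dim is -oo when there is no invariant
   probability measure. *)
Definition dyn_dim (R : realType) (G : groupType) (X : metricType R)
    (T : G -> X -> X) : \bar R :=
  ereal_sup [set
    ereal_inf [set
      ereal_sup [set r | exists (x0 : X) (mu : probability (borel x0) R),
                   T_invariant T mu /\
                   r = (\int[mu]_x (cover_ord R V x)%:E)%E]
    | V in [set V | Cov X V /\ refines V U]]
  | U in Cov X].

(* Mean dimension computed along the sequence F; by the Ornstein-Weiss lemma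
   the limits exist and do not depend on the Folner sequence F. *)
Definition mdim (R : realType) (G : groupType) (X : metricType R)
    (T : G -> X -> X) (F : nat -> {fset G}) : \bar R :=
  ereal_sup [set
    limn (fun n => ((#|` F n|%:R^-1 : R)%:E *
      ereal_inf [set
        ereal_sup [set (cover_ord R V x)%:E | x in [set: X]]
      | V in [set V | Cov X V /\ refines V (joined_cover T (F n) U)]])%E)
  | U in Cov X].

(* Main.v *)
Require Import Defs.
From HB Require Import structures.
From mathcomp Require Import all_boot all_order all_algebra finmap.
From mathcomp Require Import all_classical all_reals all_analysis.

(** Let V be a finite open cover refining U; write ord(V) = -1 + sum_i 1_(V_i).
    The proof compares three quantities: the order of a cover refining the join
    of the translates T_g(V), g in F_n; the average of ord(V) along the orbit
    piece of F_n; and the integral of ord(V) against an invariant measure.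

    From the join to the average. Choose continuous functions phi_i >= 0,
    without common zero, and closed sets C_i with {phi_i > 0} <= C_i <= V_i
    ([numerable_shrinking]). For each g, the numbers
    phi_i(T_g^-1 x) cut an interval into consecutive pieces labelled by i.
    Superposing these subdivisions for all g in F_n gives pieces labelled by
    vectors (v_g), and the cell of v is the set of x at which the label v occurs.
    This is the staircase triangulation of a product of simplices in disguise.
    Cells are open, cover X, and refine the join; the labels occurring at x form
    a chain, so there are at most 1 + sum_g ord({phi > 0}, T_g^-1 x) of them
    ([staircase_order], [joined_cover_order]). Thus, if the n-th term of the mean
    dimension exceeds r, some x_n has an average of ord({phi > 0}) of at least r.

    From the average to a measure. The empirical measures on the orbit pieces of
    the x_n have a limit, along an ultrafilter, on every subset of X; it is a
    finitely additive probability m, and the Folner condition makes it invariant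
    on all sets. Its inner values on open sets, by closed subsets, and the outer
    measure they generate yield an invariant Borel probability mu with
    m(K) <= mu(O) for K closed contained in O open ([content_regularization]).
    Passing to the limit with {phi_i > 0} <= C_i <= V_i costs nothing:
    r <= -1 + sum_i m({phi_i > 0}) <= -1 + sum_i m(C_i) <= -1 + sum_i mu(V_i),
    which is the integral of ord(V) ([exists_invariant_measure_order_ge]).

    The argument applies to a convergent sequence of terms, with r any number
    below its limit. The limit of a divergent sequence is 0 by convention, and
    the case r = 0 of the same argument shows that 0 is below the dimension as
    soon as X is nonempty. *)

Set Implicit Arguments.
Unset Strict Implicit.
Unset Printing Implicit Defensive.
Import Order.TTheory GRing.Theory Num.Theory.
Import numFieldNormedType.Exports.

Local Open Scope classical_set_scope.
Local Open Scope ring_scope.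

(** * Shrinking open covers of a compact metric space *)

Lemma mdist_continuous (R : realType) (X : metricType R) (x : X) :
  continuous (mdist x : X -> R).
Proof.
move=> y; apply/cvgrPdist_lt => e e0.
near=> z.
have yz : mdist y z < e by near: z; have := nbhsx_ballx y _ e0; rewrite ballEmdist.
apply: le_lt_trans yz; rewrite ler_norml; apply/andP; split.
  by rewrite lerNl opprB lerBlDl metric_triangle.
by rewrite lerBlDl addrC [mdist y z]metric_sym addrC metric_triangle.
Unshelve. all: by end_near. Qed.

Lemma finite_open_subcover (R : realType) (X : metricType R)
    (I : choiceType) (O : I -> set X) (K : set X) :
  compact [set: X] -> closed K -> (forall i, open (O i)) ->
  (forall x, K x -> exists i, O i x) ->
  exists D : {fset I}, forall x, K x -> exists2 i, i \in D & O i x.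
Proof.
move=> cptX cK oO covO.
have [[x0 _]|X0] := pselect ([set: X] !=set0); last first.
  by exists fset0 => x; case: X0; exists x.
(* X with x0 as distinguished point, same topology. *)
pose pX : ptopologicalType := HB.pack (X : Type) X (isPointed.Build X x0).
have : @compact pX K by exact: (@subclosed_compact X K _ cK cptX).
rewrite compact_cover => /(_ I setT O) []//.
- by move=> x Kx; have [i Oix] := covO x Kx; exists i.
- move=> D _ covD; exists D => x Kx.
  by have [i /= iD Oix] := covD x Kx; exists i.
Qed.

(** Around each point choose a closed ball contained in some V i, and extract a
    finite subcover by the open balls. phi i is the sum of the cone functions
    max(0, r_x - d(x, y)) of the balls assigned to i, C i the union of the
    corresponding closed balls. *)
Lemma numerable_shrinking (R : realType) (X : metricType R) (I : finType)
    (V : I -> set X) :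
  compact [set: X] -> (forall i, open (V i)) -> (forall x, exists i, V i x) ->
  exists (phi : I -> X -> R) (C : I -> set X),
    [/\ forall i, continuous (phi i), forall i x, 0 <= phi i x,
        forall x, exists i, 0 < phi i x &
        forall i, [/\ closed (C i), C i `<=` V i &
                      forall x, 0 < phi i x -> C i x]].
Proof.
move=> cptX oV covV.
have /choice[ir irP] : forall x, exists ir : I * R, 0 < ir.2 /\
    [set y | mdist x y <= ir.2] `<=` V ir.1.
  move=> x; have [i Vix] := covV x.
  have /nbhs_ballP[e /= e0] := open_nbhs_nbhs (conj (oV i) Vix).
  rewrite ballEmdist => eV; exists (i, e / 2) => /=; split.
    by rewrite divr_gt0.
  move=> y /= xy; apply: eV => /=; apply: le_lt_trans xy _.
  by rewrite ltr_pdivrMr// mulr_natr mulr2n ltrDl.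
have [||x|D covD] := @finite_open_subcover R X X (fun x => ball x (ir x).2) setT cptX.
- exact: closedT.
- by move=> x; rewrite ballEmdist; apply: open_comp (@open_lt R _) => ? _;
  exact: mdist_continuous.
- by move=> _; exists x; apply: ballxx; have [] := irP x.
pose bump x y : R := Num.max 0 ((ir x).2 - mdist x y).
exists (fun i y => \sum_(x <- D | (ir x).1 == i) bump x y).
exists (fun i => \bigcup_(x in [set x | x \in D /\ (ir x).1 = i])
                   [set y | mdist x y <= (ir x).2]).
have bump_ge0 x y : 0 <= bump x y by rewrite le_max lexx.
split.
- move=> i; apply: continuous_big => [|x _ y]; first exact: add_continuous.
  have -> : bump x = (fun=> 0 : R^o) \max (fun y => (ir x).2 - mdist x y).
    by [].
  apply: continuous_max; first exact: cvg_cst.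
  by apply: cvgB; [exact: cvg_cst|exact: mdist_continuous].
- by move=> i y; apply: sumr_ge0.
- move=> y; have [x xD] := covD y Logic.I; rewrite ballEmdist/= => xy.
  exists (ir x).1; rewrite (big_rem x)//= eqxx.
  apply: ltr_wpDr; first by apply: sumr_ge0.
  by rewrite lt_max subr_gt0 xy orbT.
- move=> i; split.
  + apply: closed_bigcup.
      by apply: (@sub_finite_set _ _ [set` D]) => // x [].
    move=> x _; apply: (@preimage_closed _ _ (mdist x : X -> R) [set r | r <= (ir x).2]).
      by move=> ? _; exact: mdist_continuous.
    exact: closed_le.
  + by move=> y [x [_ <-]]; have [_] := irP x; exact.
  + move=> y; apply: contraPP => nC; apply/negP; rewrite -leNgt.
    rewrite big_seq_cond big1// => x /andP[xD /eqP xi].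
    apply/max_idPl; rewrite subr_le0 leNgt; apply/negP => xy; apply: nC.
    by exists x => //=; exact: ltW.
Qed.

(** * The staircase refinement of a join of covers *)

Definition partial_sum (R : realType) (X : Type) (k : nat)
    (phi : 'I_k -> X -> R) (j : nat) (x : X) : R :=
  \sum_(i < k | (i < j)%N) phi i x.

(** The label i of the a-th subdivision occupies the interval between
    partial_sum (phi a) i x and partial_sum (phi a) i.+1 x. The intervals of the
    labels v a, for a in J, have a common interior point exactly when every left
    end is smaller than every right end, which is how the cell is expressed. *)
Definition staircase_cell (R : realType) (X : Type) (k : nat) (J : finType)
    (phi : J -> 'I_k -> X -> R) (v : {ffun J -> 'I_k}) : set X :=
  [set x | forall a b : J,
     partial_sum (phi a) (v a) x < partial_sum (phi b) (v b).+1 x].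

Section staircase.
Context (R : realType) (X : topologicalType) (k : nat) (J : finType).
Variable phi : J -> 'I_k -> X -> R.
Hypothesis phi_ge0 : forall a i x, 0 <= phi a i x.
Implicit Types (v w : {ffun J -> 'I_k}) (a b : J) (i : 'I_k) (x : X).

Local Notation psum a := (partial_sum (phi a)).

Let pos a x := [set i | 0 < phi a i x]%SET.
Let rank a i x : nat := #|[set j in pos a x | (j < i)%N]%SET|.

Lemma partial_sumS a i x : psum a i.+1 x = psum a i x + phi a i x.
Proof.
rewrite /partial_sum (bigD1 i)//= addrC; congr (_ + _).
by apply: eq_bigl => j; rewrite ltnS andbC ltn_neqAle.
Qed.

Lemma partial_sum_le a (m n : nat) x : (m <= n)%N -> psum a m x <= psum a n x.
Proof.
move=> mn; rewrite /partial_sum [leRHS](bigID (fun i : 'I_k => (i < m)%N))/=.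
rewrite [X in _ <= X + _](eq_bigl (fun i : 'I_k => (i < m)%N)); last first.
  by move=> i; rewrite andb_idl// => /leq_trans; exact.
by rewrite lerDl; apply: sumr_ge0 => i _; exact: phi_ge0.
Qed.

(** For b = a, the condition says that the interval of v a has positive
    length. *)
Lemma staircase_cell_pos v x a : staircase_cell phi v x -> 0 < phi a (v a) x.
Proof. by move=> /(_ a a); rewrite partial_sumS ltrDl. Qed.

Lemma staircase_cell_open v :
  (forall a i, continuous (phi a i)) -> open (staircase_cell phi v).
Proof.
move=> phiC.
have SC a n : continuous (psum a n).
  by apply: continuous_big => [|i _]; [exact: add_continuous|exact: phiC].
rewrite openE => x vx; apply: filter_forall => a; apply: filter_forall => b.
apply: open_nbhs_nbhs; split; last exact: vx.
have := @open_comp X R (fun y => psum b (v b).+1 y - psum a (v a) y) [set r | 0 < r].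
under [_ @^-1` _]eq_set do rewrite /= subr_gt0.
apply; last exact: open_gt.
by move=> y _; apply: cvgB; exact: SC.
Qed.

(** The label vector seen just to the right of 0: each v a is the first index i
    with phi a i x > 0, so all left ends are 0 and all right ends positive. *)
Lemma staircase_cell_cover x :
  (forall a, exists i, 0 < phi a i x) -> exists v, staircase_cell phi v x.
Proof.
move=> posx.
have /choice[f fP] : forall a, exists i, 0 < phi a i x /\ psum a i x = 0.
  move=> a; have [i0 i0_gt0] := posx a.
  case: (@arg_minnP _ i0 (fun i => 0 < phi a i x) (@nat_of_ord k) i0_gt0).
  move=> i i_gt0 i_min; exists i; split=> //.
  apply: big1 => j ji; apply/eqP; rewrite eq_le phi_ge0 andbT leNgt.
  by apply/negP => /i_min; rewrite leqNgt ji.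
exists [ffun a => f a] => a b; rewrite !ffunE partial_sumS.
by have [_ ->] := fP a; have [? ->] := fP b; rewrite add0r.
Qed.

(** A common point of the intervals of v lies on one side of a common point of
    those of w, and labels increase from left to right in every subdivision. *)
Lemma staircase_cell_chain v w x :
  staircase_cell phi v x -> staircase_cell phi w x ->
  (forall a, v a <= w a)%N \/ (forall a, w a <= v a)%N.
Proof.
move=> vx wx; apply: contrapT => /not_orP[/existsNP[a /negP + ]].
move=> + /existsNP[b /negP]; rewrite -!ltnNge => wva vwb.
have := lt_le_trans (wx b a) (partial_sum_le a x wva).
move=> /lt_trans/(_ (vx a b)).
by move=> /lt_le_trans/(_ (partial_sum_le b x vwb)); rewrite ltxx.
Qed.

(** Among the labels present at x, a vector is determined by its height, the sum
    over a of the rank of v a among the indices i with phi a i x > 0: on a chain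
    the height is strictly increasing. The rank of v a is at most the number of
    these indices minus one. *)
Lemma staircase_order x :
  (#|[set v | `[< staircase_cell phi v x >]]%SET| <=
     (\sum_(a : J) #|[set i | (0 < phi a i x)%R]%SET|.-1).+1)%N.
Proof.
set N := (\sum_a _)%N; set W := [set v | _]%SET.
have rank_mono a (i j : 'I_k) : (i <= j)%N -> (rank a i x <= rank a j x)%N.
  move=> ij; apply/subset_leq_card/fintype.subsetP => l; rewrite !inE => /andP[-> li].
  exact: leq_trans ij.
have rank_lt a (i j : 'I_k) : 0 < phi a i x -> (i < j)%N ->
    (rank a i x < rank a j x)%N.
  move=> i_gt0 ij; apply/proper_card/properP; split.
    apply/fintype.subsetP => l; rewrite !inE => /andP[-> li]; exact: ltn_trans ij.
  by exists i; rewrite !inE ?i_gt0// ltnn andbF.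
have rank_le a (v : {ffun J -> 'I_k}) : staircase_cell phi v x ->
    (rank a (v a) x <= (#|pos a x|).-1)%N.
  move=> /(staircase_cell_pos a) va; rewrite -ltnS prednK; last first.
    by apply/card_gt0P; exists (v a); rewrite inE.
  apply/proper_card/properP; split.
    by apply/fintype.subsetP => l; rewrite !inE => /andP[].
  by exists (v a); rewrite !inE ?ltnn ?andbF.
have inW v : v \in W -> staircase_cell phi v x by rewrite inE => /asboolP.
(* Height is injective on the labels present at x, by the chain property. *)
pose height v := (\sum_a rank a (v a) x)%N.
have height_le v : v \in W -> (height v <= N)%N.
  by move=> /inW vx; apply: leq_sum => a _; exact: rank_le.
have height_inj v w : v \in W -> w \in W -> (forall a, v a <= w a)%N ->
    height v = height w -> v = w.
  move=> /inW vx /inW wx vw /eqP.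
  have /leqif_sum -> : forall a, true -> (rank a (v a) x <= rank a (w a) x
      ?= iff (rank a (v a) x == rank a (w a) x))%N.
    by move=> a _; apply/leqifP; rewrite eq_sym; case: ltngtP (rank_mono a _ _ (vw a)).
  move=> /forallP/= e; apply/ffunP => a; apply/val_inj/eqP => /=.
  rewrite eqn_leq vw leqNgt; apply/negP => lt_a.
  have := rank_lt a _ _ (staircase_cell_pos a vx) lt_a.
  by rewrite (eqP (e a)) ltnn.
pose f v : 'I_N.+1 := inord (height v).
have f_inj : {in W &, injective f}.
  move=> v w vW wW /(congr1 (@nat_of_ord _)).
  rewrite !inordK ?ltnS ?height_le// => e.
  have [vw|wv] := staircase_cell_chain (inW _ vW) (inW _ wW); first exact: height_inj.
  by apply/esym/height_inj.
by rewrite -(card_in_imset f_inj) (leq_trans (max_card _))// card_ord.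
Qed.

End staircase.

(** An inequality only, because two indices j may give the same set. *)
Lemma cover_ord_range (R : realType) (X : Type) (J : finType) (W : J -> set X)
    (x : X) :
  cover_ord R (range W) x <= -1 + #|[set j | `[< W j x >]]%SET|%:R.
Proof.
have finW : finite_set (range W) by apply: finite_image; exact: finite_finset.
rewrite lerD2l fsbig_finite//=.
under eq_bigr do rewrite indicE.
rewrite -natr_sum ler_nat.
have -> : (\sum_(A <- fset_set (range W)) (x \in A) =
    count (fun A => x \in A) (fset_set (range W)))%N.
  by rewrite -sum1_count [RHS]big_mkcond; apply: eq_bigr => A _; case: (x \in A).
rewrite -size_filter.
rewrite cardE -(size_map W); apply: uniq_leq_size.
  exact/filter_uniq/fset_uniq.
move=> A; rewrite mem_filter in_fset_set// => /andP[/set_mem Ax].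
move=> /set_mem[j _ jA].
by apply/mapP; exists j => //; rewrite mem_enum inE jA; exact/asboolP.
Qed.

Lemma cover_ord_nth (R : realType) (X : Type) (V : set (set X)) (x : X) :
  finite_set V ->
  cover_ord R V x =
    -1 + \sum_(i < #|` fset_set V|) \1_(nth set0 (fset_set V) i) x.
Proof.
by move=> finV; rewrite /cover_ord fsbig_finite//= (big_nth set0) big_mkord.
Qed.

(** * Borel measures from finitely additive ones *)

Section content_regularization.
Local Open Scope ereal_scope.
Context (R : realType) (X : metricType R) (m : set X -> R).
Hypothesis cptX : compact [set: X].
Hypothesis m_ge0 : forall A, (0 <= m A)%R.
Hypothesis m_additive :
  forall A B, A `&` B = set0 -> (m (A `|` B) = m A + m B)%R.
Hypothesis m_setT : m setT = 1%R.
Implicit Types A B O K : set X.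

Lemma additive_le A B : A `<=` B -> (m A <= m B)%R.
Proof.
move=> AB; rewrite -(setDUK AB) m_additive ?lerDl//.
by rewrite setDE setICA setICr setI0.
Qed.

Lemma additive_set0 : m set0 = 0%R.
Proof.
have := m_additive (setI0 (set0 : set X)); rewrite setU0 => /eqP.
by rewrite -[X in X == _]addr0 => /eqP/addrI/esym.
Qed.

Lemma additive_bigsetU (I : Type) (s : seq I) (P : pred I) (A : I -> set X) :
  (m (\big[setU/set0]_(i <- s | P i) A i) <= \sum_(i <- s | P i) m (A i))%R.
Proof.
elim/big_rec2 : _ => [|i r B _ Br]; first by rewrite additive_set0.
rewrite -(setDUK (@subsetUl _ (A i) B)) m_additive; last first.
  by rewrite setDE setICA setICr setI0.
by rewrite lerD2l (le_trans _ Br)// additive_le// setDE => x [[]].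
Qed.

(** inner_content is a content in the sense of Halmos, read off closed subsets,
    and outer_content the outer measure that it generates. *)
Definition inner_content O : \bar R :=
  ereal_sup [set (m K)%:E | K in [set K | closed K /\ K `<=` O]].

Definition outer_content A : \bar R :=
  ereal_inf [set inner_content O | O in [set O | open O /\ A `<=` O]].

Lemma inner_ub K O : closed K -> K `<=` O -> (m K)%:E <= inner_content O.
Proof. by move=> cK KO; apply: ereal_sup_ubound; exists K. Qed.

Lemma inner_ge0 O : 0 <= inner_content O.
Proof.
by rewrite (le_trans _ (inner_ub closed0 (@sub0set _ O)))// lee_fin.
Qed.

Lemma inner_mono O O' : O `<=` O' -> inner_content O <= inner_content O'.
Proof.
move=> OO'; apply: ge_ereal_sup => _ [K [cK KO] <-].
by apply: inner_ub => //; exact: subset_trans OO'.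
Qed.

Lemma inner_le1 O : inner_content O <= 1.
Proof.
apply: ge_ereal_sup => _ [K _ <-]; rewrite lee_fin -m_setT.
exact: additive_le.
Qed.

Lemma inner_fin_num O : inner_content O \is a fin_num.
Proof.
by rewrite ge0_fin_numE ?inner_ge0// (le_lt_trans (inner_le1 O))// ltey.
Qed.

Lemma outer_le A O : open O -> A `<=` O -> outer_content A <= inner_content O.
Proof. by move=> oO AO; apply: ereal_inf_lbound; exists O. Qed.

Lemma outer_ge0 A : 0 <= outer_content A.
Proof. by apply: le_ereal_inf_tmp => _ [U _ <-]; exact: inner_ge0. Qed.

Lemma outer_fin_num A : outer_content A \is a fin_num.
Proof.
rewrite ge0_fin_numE ?outer_ge0//; apply: (@le_lt_trans _ _ 1); last exact: ltey.
exact: le_trans (outer_le openT (@subsetT _ A)) (inner_le1 _).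
Qed.

Lemma outer_mono A B : A `<=` B -> outer_content A <= outer_content B.
Proof.
move=> AB; apply: le_ereal_inf_tmp => _ [U [oU BU] <-].
by apply: outer_le => //; exact: subset_trans BU.
Qed.

Lemma outer_open O : open O -> outer_content O = inner_content O.
Proof.
move=> oO; apply/eqP; rewrite eq_le outer_le//=.
by apply: le_ereal_inf_tmp => _ [U [_ OU] <-]; exact: inner_mono.
Qed.

Lemma outer_set0 : outer_content set0 = 0.
Proof.
rewrite outer_open; last exact: open0.
apply/eqP; rewrite eq_le inner_ge0 andbT.
apply: ge_ereal_sup => _ [K [_ +] <-]; rewrite subset0 => ->.
by rewrite additive_set0.
Qed.

(** A closed K contained in the union of the O n lies in finitely many of them;
    shrinking the cover of X formed by these and the complement of K splits K
    into closed pieces, each contained in one O n. *)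
Lemma inner_sigma_subadditive (O : nat -> set X) :
  (forall n, open (O n)) ->
  inner_content (\bigcup_n O n) <= \sum_(n <oo) inner_content (O n).
Proof.
move=> oO; apply: ge_ereal_sup => _ [K [cK KO] <-].
have [|D KD] := finite_open_subcover cptX cK oO.
  by move=> x /KO[n _ Onx]; exists n.
(* The sets O i with i < N contain the finite subcover indexed by D. *)
pose N := (\max_(i <- D) i).+1.
pose V (i : option 'I_N) := if i is Some i then O i else ~` K.
have [| |phi [C [_ _ phi_gt0 phiC]]] := @numerable_shrinking R X _ V cptX.
- by move=> [i|]; [exact: oO|exact: closed_openC].
- move=> x; have [Kx|nKx] := pselect (K x); last by exists None.
  have [n nD Onx] := KD x Kx.
  have nN : (n < N)%N by rewrite ltnS; exact: leq_bigmax_seq.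
  by exists (Some (Ordinal nN)).
apply: (@le_trans _ _ (\sum_(i < N) inner_content (O i))); last first.
  rewrite -(big_mkord xpredT (fun i => inner_content (O i))).
  by apply: nneseries_lim_ge => n _ _; exact: inner_ge0.
apply: (@le_trans _ _ (\sum_(i < N) (m (K `&` C (Some i)))%:E)); last first.
  apply: lee_sum => i _; have [cC CV _] := phiC (Some i).
  by apply: inner_ub; [exact: closedI|move=> x [_ /CV]].
rewrite sumEFin lee_fin; apply: le_trans (additive_bigsetU _ _ _).
apply: additive_le => x Kx; have [i phix] := phi_gt0 x.
have [_ CV /(_ x phix) Cx] := phiC i.
case: i phix CV Cx => [i|] _ CV Cx; last by have := CV _ Cx.
by rewrite (bigD1 i)//=; left.
Qed.

Lemma outer_sigma_subadditive : sigma_subadditive outer_content.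
Proof.
move=> A; apply/lee_addgt0Pr => e e0.
have /choice[W WP] : forall n, exists W, [/\ open W, A n `<=` W &
    inner_content W <= outer_content (A n) + (e / (2 ^ n.+1)%:R)%:E].
  move=> n; have en : (0 < e / (2 ^ n.+1)%:R)%R.
    by rewrite divr_gt0// ltr0n expn_gt0.
  have [_ [W [oW AW] <-] /ltW We] := lb_ereal_inf_adherent en (outer_fin_num (A n)).
  by exists W.
apply: le_trans (epsilon_trick xpredT (fun n => outer_ge0 (A n)) (ltW e0)).
apply: (@le_trans _ _ (\sum_(n <oo) inner_content (W n))); last first.
  apply: lee_nneseries => n *; first exact: inner_ge0.
  by have [] := WP n.
have oW n : open (W n) by have [] := WP n.
apply: le_trans (inner_sigma_subadditive oW).
apply: outer_le; first exact: bigcup_open.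
by apply: subset_bigcup => n _; have [] := WP n.
Qed.

Let mu : {outer_measure set X -> \bar R} :=
  HB.pack outer_content
    (isOuterMeasure.Build R X outer_content outer_set0 outer_ge0 outer_mono
       outer_sigma_subadditive).

(** For G open containing the test set, exhaust G `&` O by a closed K, then the
    open set G minus K, which contains the part of G outside O, by a closed L:
    K and L are disjoint closed subsets of G, and m is additive on them. *)
Lemma open_caratheodory O : open O -> mu.-caratheodory O.
Proof.
move=> oO; apply: le_caratheodory_measurable => A.
apply: le_ereal_inf_tmp => _ [G [oG AG] <-].
apply: (@le_trans _ _ (inner_content (G `&` O) + outer_content (G `&` ~` O))).
  apply: leeD; last by apply: outer_mono; exact: setSI.
  by apply: outer_le; [exact: openI|exact: setSI].
rewrite -leeBrDr ?outer_fin_num//; apply: ge_ereal_sup => _ [K [cK KGO] <-].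
rewrite leeBrDr ?outer_fin_num// addeC -leeBrDr//.
apply: (@le_trans _ _ (inner_content (G `\` K))).
  apply: outer_le; first by apply: openI => //; exact: closed_openC.
  by move=> x [Gx nOx]; split=> // /KGO[].
apply: ge_ereal_sup => _ [L [cL LGK] <-].
rewrite leeBrDr// -EFinD -m_additive; last first.
  by apply/seteqP; split => // x [/LGK[]].
by apply: inner_ub; [exact: closedU|move=> x [/LGK[]|/KGO[]]].
Qed.

Lemma borel_caratheodory (x0 : X) (A : set (borel x0)) :
  measurable A -> mu.-caratheodory A.
Proof.
apply: smallest_sub => [|B oB]; last exact: open_caratheodory.
split; first exact: caratheodory_measurable_set0.
- by move=> B mB; rewrite setTD; exact: caratheodory_measurable_setC.
- by move=> B mB; exact: caratheodory_measurable_bigcup.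
Qed.

Lemma outer_semi_sigma_additive (x0 : X) :
  semi_sigma_additive (outer_content : set (borel x0) -> \bar R).
Proof.
move=> F mF tF mUF.
apply: (@caratheodory_measure_sigma_additive R (pointed_at x0) mu) => //.
- by move=> i; exact: borel_caratheodory (mF i).
- exact: borel_caratheodory mUF.
Qed.

Lemma outer_setT : outer_content setT = 1.
Proof.
rewrite outer_open; last exact: openT.
apply/eqP; rewrite eq_le inner_le1 /=.
by have := inner_ub closedT (@subset_refl _ setT); rewrite m_setT.
Qed.

Lemma outer_preimage (f g : X -> X) A : continuous f -> continuous g ->
  cancel f g -> cancel g f -> (forall B, m (f @^-1` B) = m B) ->
  outer_content (f @^-1` A) = outer_content A.
Proof.
move=> fC gC fK gK mf.
have le_outer (h k : X -> X) B : continuous h -> continuous k ->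
    cancel h k -> cancel k h -> (forall B, m (k @^-1` B) = m B) ->
    outer_content (h @^-1` B) <= outer_content B.
  move=> hC kC hK kK mk; apply: le_ereal_inf_tmp => _ [U [oU BU] <-].
  apply: (@le_trans _ _ (inner_content (h @^-1` U))).
    apply: outer_le; last exact: preimage_subset.
    by apply: open_comp => // x _; exact: hC.
  apply: ge_ereal_sup => _ [K [cK KU] <-].
  rewrite -mk; apply: inner_ub; last by move=> x /KU /=; rewrite kK.
  by apply: preimage_closed => // x _; exact: kC.
have mg B : m (g @^-1` B) = m B.
  rewrite -[in RHS](_ : f @^-1` (g @^-1` B) = B) ?mf//.
  by apply/seteqP; split => x /=; rewrite fK.
apply/eqP; rewrite eq_le (le_outer f g)//=.
rewrite -{1}(_ : g @^-1` (f @^-1` A) = A) ?(le_outer g f)//.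
by apply/seteqP; split => x /=; rewrite gK.
Qed.

(** m itself need not be countably additive on Borel sets, but it is dominated on
    pairs K closed, O open by a Borel probability that inherits every symmetry
    of m under homeomorphisms. *)
Lemma content_regularization (x0 : X) :
  exists mu : probability (borel x0) R,
    (forall K O, closed K -> open O -> K `<=` O -> (m K)%:E <= mu O) /\
    (forall f g : X -> X, continuous f -> continuous g ->
       cancel f g -> cancel g f -> (forall B, m (f @^-1` B) = m B) ->
     forall A : set (borel x0), mu (f @^-1` A) = mu A).
Proof.
pose nu : set (borel x0) -> \bar R := outer_content.
pose numeas := isMeasure.Build _ (borel x0) R nu outer_set0 outer_ge0
  (@outer_semi_sigma_additive x0).
pose mnu : {measure set (borel x0) -> \bar R} := HB.pack nu numeas.
pose nuprob := Measure_isProbability.Build _ (borel x0) R mnu outer_setT.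
pose pnu : probability (borel x0) R := HB.pack nu numeas nuprob.
exists pnu; split => [K O cK oO KO|f g fC gC fK gK mf A].
  by rewrite /= /nu outer_open//; exact: inner_ub.
exact: outer_preimage fC gC fK gK mf.
Qed.

End content_regularization.

(** * Invariant measures as limits of empirical measures *)

(** A single ultrafilter serves all the sequences at once, so that linear
    relations between the u s pass to the limits. The index type may be
    uncountable, as the type of all subsets of X below, which rules out the
    extraction of a common subsequence. *)
Lemma ultralimit (R : realType) (S : Type) (u : S -> nat -> R) :
  (forall s n, 0 <= u s n <= 1) ->
  exists (W : set_system nat) (l : S -> R),
    [/\ ProperFilter W, \oo `<=` W & forall s, u s @ W --> l s].
Proof.
move=> u01; have [W [ultraW ooW]] := @ultraFilterLemma nat \oo _.
have /choice[l lP] : forall s, exists l : R, u s @ W --> l.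
  move=> s; have := @segment_compact R 0 1 (u s @ W) _.
  case=> [|l [_ cl]].
    by apply: (@filterE _ W) => n; rewrite /= in_itv/= u01.
  exists l => B Bl; have [//|WnB] := in_ultra_setVsetC (u s @^-1` B) ultraW.
  by have [r [nBr Br]] := cl (~` B) B WnB Bl.
by exists W, l; split => //; exact: ultra_proper.
Qed.

Lemma dist_sum_fsymdiff (R : realType) (K : choiceType) (A B : {fset K})
    (h : K -> R) : (forall i, 0 <= h i <= 1) ->
  `|\sum_(i <- A) h i - \sum_(i <- B) h i| <= #|` fsymdiff A B|%:R.
Proof.
move=> h01.
have h_ge0 i : 0 <= h i by case/andP: (h01 i).
have sumE (C D : {fset K}) : \sum_(i <- C) h i =
    \sum_(i <- (C `&` D)%fset) h i + \sum_(i <- (C `\` D)%fset) h i.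
  rewrite (big_fsetID _ (fun i => i \in D))/=.
  rewrite (_ : [fset i in C | i \in D]%fset = (C `&` D)%fset).
    rewrite (_ : [fset i in C | i \notin D]%fset = (C `\` D)%fset)//.
    by apply/fsetP => i; rewrite !inE andbC.
  by apply/fsetP => i; rewrite !inE.
have sum_le (C : {fset K}) : \sum_(i <- C) h i <= #|` C|%:R.
  rewrite -sum1_size natr_sum; apply: ler_sum => i _.
  by case/andP: (h01 i).
rewrite (sumE A B) (sumE B A) fsetIC.
rewrite [X in X - _]addrC addrKA ler_norml lerNl opprB.
rewrite /fsymdiff cardfsU (_ : ((A `\` B) `&` (B `\` A) = fset0)%fset); last first.
  by apply/fsetP => i; rewrite !inE; case: (i \in A); case: (i \in B).
rewrite cardfs0 subn0 natrD; apply/andP; split.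
  apply: le_trans (_ : #|` (B `\` A)%fset|%:R <= _); last by rewrite lerDr.
  by rewrite lerBlDr (le_trans (sum_le _))// lerDl sumr_ge0.
apply: le_trans (_ : #|` (A `\` B)%fset|%:R <= _); last by rewrite lerDl.
by rewrite lerBlDr (le_trans (sum_le _))// lerDl sumr_ge0.
Qed.

Section invariant_measure.
Context (R : realType) (G : groupType) (X : metricType R) (T : G -> X -> X).
Hypothesis T_system : dynamical_system T.
Implicit Types (g h : G) (A B : set X).

Lemma system_compact : compact [set: X]. Proof. by case: T_system. Qed.

Lemma system_continuous g : continuous (T g).
Proof. by case: T_system => _ /(_ g)[f' []]. Qed.

Lemma systemM g h x : T (g * h)%g x = T g (T h x).
Proof. by case: T_system => _ _ ->. Qed.

Lemma system1 x : T 1%g x = x.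
Proof.
case: T_system => _ /(_ 1%g)[f' [fK _ _ _]] _.
by apply: (can_inj fK); rewrite -systemM mulg1.
Qed.

Lemma systemK g : cancel (T g) (T g^-1%g).
Proof. by move=> x; rewrite -systemM mulVg system1. Qed.

Lemma systemVK g : cancel (T g^-1%g) (T g).
Proof. by move=> x; rewrite -systemM mulgV system1. Qed.

(** Points are moved by inverses, as x lies in T g @` B exactly when T g^-1 x lies
    in B; these are the orbit pieces seen by the join of the T g @` B. *)
Definition empirical (D : {fset G}) (x : X) (A : set X) : R :=
  #|` D|%:R^-1 * \sum_(g <- D) \1_A (T g^-1%g x).

Lemma empirical01 D x A : 0 <= empirical D x A <= 1.
Proof.
rewrite mulr_ge0 ?invr_ge0 ?sumr_ge0//=.
have [->|D0] := eqVneq D fset0; first by rewrite /empirical big_nil mulr0.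
rewrite /empirical mulrC ler_pdivrMr ?ltr0n ?cardfs_gt0// mul1r.
rewrite -sum1_size natr_sum; apply: ler_sum => g _.
by rewrite indicE lern1; case: (_ \in _).
Qed.

Lemma empiricalU D x A B : A `&` B = set0 ->
  empirical D x (A `|` B) = empirical D x A + empirical D x B.
Proof.
move=> AB; rewrite /empirical -mulrDr -big_split/=; congr (_ * _).
apply: eq_bigr => g _; rewrite !indicE in_setU.
have := in_set0 (T g^-1%g x); rewrite -AB in_setI.
by do 2 case: (_ \in _) => //=; rewrite ?addr0 ?add0r.
Qed.

Lemma empirical_setT D x : D != fset0 -> empirical D x setT = 1.
Proof.
move=> D0; rewrite /empirical.
under eq_bigr do rewrite indicT.
by rewrite big_const_seq count_predT iter_addr_0 mulVf// pnatr_eq0 cardfs_eq0.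
Qed.

(** T g (T k^-1 x) = T (k g^-1)^-1 x, so that applying T g replaces D by its right
    translate by g^-1. *)
Lemma empirical_folner D x g B :
  `|empirical D x (T g @^-1` B) - empirical D x B| <= folner_ratio R D g^-1%g.
Proof.
pose h k : R := \1_B (T k^-1%g x).
have -> : empirical D x (T g @^-1` B) =
    #|` D|%:R^-1 * \sum_(k <- right_translate D g^-1%g) h k.
  rewrite /empirical /right_translate big_imfset/=; last first.
    by move=> a b _ _ /mulIg.
  congr (_ * _); apply: eq_bigr => k _; rewrite /h.
  rewrite invgF systemM.
  by rewrite !indicE.
rewrite /empirical /folner_ratio -mulrBr normrM ger0_norm ?invr_ge0//.
rewrite mulrC ler_wpM2r ?invr_ge0//; apply: dist_sum_fsymdiff => k.
by rewrite /h indicE ler0n lern1; case: (_ \in _).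
Qed.

(** The lower bound survives the passage to the limit although the indicator of
    an open set is only lower semicontinuous: it is given on A i, the limit is
    taken on A i itself, and the closed set C i lies between A i and O i. *)
Lemma exists_invariant_measure_ge (F : nat -> {fset G}) (x : nat -> X) (k : nat)
    (C O A : 'I_k -> set X) (r : R) :
  folner_sequence R F ->
  (forall i, [/\ closed (C i), open (O i), A i `<=` C i & C i `<=` O i]) ->
  (\forall n \near \oo, r <= \sum_(i < k) empirical (F n) (x n) (A i)) ->
  exists (x0 : X) (mu : probability (borel x0) R),
    T_invariant T mu /\ (r%:E <= \sum_(i < k) mu (O i))%E.
Proof.
move=> [F0 F_folner] ACO rA.
have [W [m [PW ooW mP]]] :=
  ultralimit (fun B n => empirical01 (F n) (x n) B).
have m_ge0 B : 0 <= m B.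
  have := closed_cvg (fun r : R => 0 <= r) (@closed_ge _ _) _ _ (mP B).
  by apply; apply: nearW => n; case/andP: (empirical01 (F n) (x n) B).
have m_additive B B' : B `&` B' = set0 -> m (B `|` B') = m B + m B'.
  move=> BB'; apply: (cvg_unique _ (mP (B `|` B'))) => //.
  rewrite /=; under eq_fun do rewrite empiricalU//.
  exact: cvgD.
have m_setT : m setT = 1.
  apply: (cvg_unique _ (mP setT)) => //.
  by rewrite /=; under eq_fun do rewrite empirical_setT//; exact: cvg_cst.
have m_invariant g B : m (T g @^-1` B) = m B.
  apply/eqP; rewrite -subr_eq0; apply/eqP.
  apply: (cvg_unique _ (cvgB (mP (T g @^-1` B)) (mP B))) => //.
  rewrite /=; apply: norm_cvg0; apply: squeeze_cvgr (cvg_cst 0) _; last first.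
    by apply: cvg_trans (F_folner g^-1%g); exact: cvg_app.
  by apply: nearW => n; rewrite normr_ge0 empirical_folner.
have rm : r <= \sum_(i < k) m (A i).
  have mA := @cvg_big R _ +%R 0 xpredT add_continuous _ W (index_enum _)
    (fun i n => empirical (F n) (x n) (A i)) (fun i => m (A i)) _
    (fun i _ => mP (A i)).
  have := closed_cvg (fun s : R => r <= s) (@closed_ge _ _) _ _ (mA _).
  by apply; exact: ooW.
have [mu [m_mu mu_inv]] :=
  content_regularization system_compact m_ge0 m_additive m_setT (x 0%N).
exists (x 0%N), mu; split.
  move=> g B _; apply: (mu_inv (T g) (T g^-1%g)).
  - exact: system_continuous.
  - exact: system_continuous.
  - exact: systemK.
  - exact: systemVK.
  - exact: m_invariant.
rewrite (le_trans _ (_ : (\sum_(i < k) (m (C i))%:E <= _)%E))//.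
  rewrite sumEFin lee_fin (le_trans rm)//; apply: ler_sum => i _.
  by have [_ _ AC _] := ACO i; exact: (additive_le m_ge0 m_additive).
by apply: lee_sum => i _; have [cC oO _ CO] := ACO i; exact: m_mu.
Qed.

End invariant_measure.

(** * Comparison of the two dimensions *)

(** Used with x the mean dimension of a cover, which may a priori be +oo. *)
Lemma le_ereal_lt_fin (R : realType) (x y : \bar R) :
  (forall r : R, (r%:E < x)%E -> (r%:E <= y)%E) -> (x <= y)%E.
Proof.
case: x => [x| |] xy; last exact: leNye.
  apply/lee_subgt0Pr => e e0; rewrite -EFinB; apply: xy.
  by rewrite lte_fin ltrBlDr ltrDl.
by rewrite leye_eq; apply/eqP/eqyP => A _; apply: xy; exact: ltey.
Qed.

Lemma refines_trans (X : Type) (U V W : set (set X)) :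
  refines W V -> refines V U -> refines W U.
Proof.
move=> WV VU A /WV[B /VU[C UC BC] AB]; exists C => //.
exact: subset_trans BC.
Qed.

Lemma refines_joined (G : groupType) (X : Type) (T : G -> X -> X)
    (D : {fset G}) (U V : set (set X)) :
  refines V U -> refines (joined_cover T D V) (joined_cover T D U).
Proof.
move=> VU.
have /choice[f fP] : forall A, exists B, V A -> U B /\ A `<=` B.
  move=> A; have [/VU[B UB AB]|nVA] := pselect (V A); first by exists B.
  by exists A.
move=> _ [B VB ->]; exists (\bigcap_(g in [set` D]) T g @` f (B g)).
  by exists (f \o B) => // g /VB/fP[].
move=> x Bx g /[dup] gD /Bx[y By <-]; exists y => //.
by have [_] := fP _ (VB g gD); exact.
Qed.

Lemma cover_ord_ge0 (R : realType) (X : topologicalType) (V : set (set X)) x :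
  Cov X V -> 0 <= cover_ord R V x.
Proof.
move=> [finV _ covV].
have [A VA Ax] : (\bigcup_(A in V) A) x by rewrite covV.
rewrite /cover_ord (fsbigD1 A)//= indicE mem_set// addrA addNr add0r.
by rewrite fsumr_ge0.
Qed.

Lemma integral_cover_ord (R : realType) (X : topologicalType) (x0 : X)
    (mu : probability (borel x0) R) (V : set (set X)) :
  finite_set V -> (forall A, V A -> open A) ->
  (\int[mu]_x (cover_ord R V x)%:E =
   - 1 + \sum_(i < #|` fset_set V|) mu (nth set0 (fset_set V) i))%E.
Proof.
move=> finV oV.
have mV (i : 'I_#|` fset_set V|) :
    measurable (nth set0 (fset_set V) i : set (borel x0)).
  apply: sub_sigma_algebra; apply: oV.
  by apply/set_mem; rewrite -in_fset_set//; exact: mem_nth.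
under eq_integral do rewrite (cover_ord_nth R _ finV) EFinD -sumEFin.
rewrite integralD//; first last.
- by apply: integrable_sum => // i _; exact: integrable_indic.
- exact: finite_measure_integrable_cst.
rewrite integral_sum//; last by move=> i; exact: integrable_indic.
rewrite (integral_cst mu measurableT (-1)%:E).
rewrite [X in (_ * X)%E](probability_setT mu) mule1.
by congr (_ + _)%E; apply: eq_bigr => i _; rewrite integral_indic// setIT.
Qed.

Section numerable_cover.
Context (R : realType) (G : groupType) (X : metricType R) (T : G -> X -> X).
Hypothesis T_system : dynamical_system T.

(** The staircase cells for the functions phi i composed with T g^-1, g in D. *)
Lemma joined_cover_order (k : nat) (phi : 'I_k -> X -> R) (V : 'I_k -> set X)
    (D : {fset G}) :
  (forall i, continuous (phi i)) -> (forall i x, 0 <= phi i x) ->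
  (forall x, exists i, 0 < phi i x) ->
  (forall i x, 0 < phi i x -> V i x) ->
  exists W, [/\ Cov X W, refines W (joined_cover T D (range V)) &
    forall x, cover_ord R W x <= \sum_(g <- D)
      (-1 + \sum_(i < k) \1_[set y | 0 < phi i y] (T g^-1%g x))].
Proof.
move=> phiC phi_ge0 phi_cover phiV.
pose psi (a : D) i x := phi i (T (val a)^-1%g x).
have psi_ge0 a i x : 0 <= psi a i x by exact: phi_ge0.
have psiC a i : continuous (psi a i).
  move=> x; apply: (@continuous_comp _ _ _ (T (val a)^-1%g) (phi i)).
    exact: system_continuous.
  exact: phiC.
exists (range (staircase_cell psi)); split.
- split; first by apply: finite_image; exact: finite_finset.
    by move=> _ [v _ <-]; exact: staircase_cell_open.
  apply/seteqP; split=> // x _.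
  have [|v vx] := @staircase_cell_cover R X k D psi psi_ge0 x.
    by move=> a; exact: phi_cover.
  by exists (staircase_cell psi v) => //; exists v.
- move=> _ [v _ <-].
  pose B g := if insub g is Some a then V (v a) else set0.
  exists (\bigcap_(g in [set` D]) T g @` B g).
    by exists B => // g gD; rewrite /B insubT; exists (v [` gD]%fset).
  move=> x vx g /= gD; exists (T g^-1%g x); last exact: systemVK.
  rewrite /B insubT; apply: phiV.
  exact: (staircase_cell_pos [` gD]%fset vx).
- move=> x; apply: le_trans (cover_ord_range _ _ _) _.
  apply: (@le_trans _ _ (-1 +
      (\sum_(a : D) #|[set i | (0 < psi a i x)%R]%SET|.-1).+1%:R)).
    by rewrite lerD2l ler_nat; exact: staircase_order.
  rewrite -natr1 addrCA addNr addr0 natr_sum big_seq_fsetE/=.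
  apply: ler_sum => a _; rewrite addrC lerBrDr.
  have pos_gt0 : (0 < #|[set i | (0 < psi a i x)%R]%SET|)%N.
    have [i phi_gt0] := phi_cover (T (val a)^-1%g x).
    by apply/card_gt0P; exists i; rewrite inE.
  rewrite natr1 prednK// -sum1_card natr_sum big_mkcond/=.
  apply: ler_sum => i _; rewrite indicE inE /psi.
  by case: ifPn => // phi_gt0; rewrite mem_set.
Qed.

Lemma sum_order_empirical (k : nat) (A : 'I_k -> set X) (D : {fset G}) x :
  D != fset0 ->
  \sum_(g <- D) (-1 + \sum_(i < k) \1_(A i) (T g^-1%g x)) =
  #|` D|%:R * (-1 + \sum_(i < k) empirical T D x (A i)) :> R.
Proof.
move=> D0; have cD : #|` D|%:R != 0 :> R by rewrite pnatr_eq0 cardfs_eq0.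
rewrite mulrDr mulr_sumr big_split/=; congr (_ + _).
  by rewrite big_const_seq count_predT iter_addr_0 mulrN1 mulNrn.
rewrite exchange_big; apply: eq_bigr => i _.
by rewrite /empirical mulrA mulfV// mul1r.
Qed.

(** This carries both uses of compactness: V is shrunk to the cover by the sets
    where phi i > 0, the hypothesis is applied to the staircase refinement of the
    join of the shrunk cover, and the points x obtained feed the empirical
    measures. *)
Lemma exists_invariant_measure_order_ge (F : nat -> {fset G})
    (V : set (set X)) (r : R) :
  folner_sequence R F -> Cov X V -> [set: X] !=set0 ->
  (\forall n \near \oo, forall W, Cov X W ->
     refines W (joined_cover T (F n) V) ->
     exists x, r * #|` F n|%:R <= cover_ord R W x) ->
  exists (x0 : X) (mu : probability (borel x0) R),
    T_invariant T mu /\ (r%:E <= \int[mu]_x (cover_ord R V x)%:E)%E.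
Proof.
move=> F_folner [finV oV covV] [x0 _] rV.
have V_nth i : (i < #|` fset_set V|)%N -> V (nth set0 (fset_set V) i).
  by move=> ik; apply/set_mem; rewrite -in_fset_set//; exact: mem_nth.
have [| |phi [C [phiC phi_ge0 phi_cover phiV]]] := @numerable_shrinking R X _
    (fun i : 'I_#|` fset_set V| => nth set0 (fset_set V) i)
    (system_compact T_system).
- by move=> i; exact/oV/V_nth.
- move=> x; have [A VA Ax] : (\bigcup_(A in V) A) x by rewrite covV.
  have AV : A \in fset_set V by rewrite in_fset_set// mem_set.
  have iA : (index A (fset_set V) < #|` fset_set V|)%N by rewrite index_mem.
  by exists (Ordinal iA); rewrite /= nth_index.
have : \forall n \near \oo, exists x,
    r <= -1 + \sum_i empirical T (F n) x [set y | 0 < phi i y].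
  apply: filterS rV => n rV.
  have phi_pos i x : 0 < phi i x -> nth set0 (fset_set V) i x.
    by have [_ CV AC] := phiV i; move=> /AC/CV.
  have [W [covW WV ordW]] :=
    joined_cover_order (F n) phiC phi_ge0 phi_cover phi_pos.
  have [|x rx] := rV W covW.
    apply: refines_trans WV _; apply: refines_joined => _ [i _ <-].
    by exists (nth set0 (fset_set V) i) => //; exact: V_nth.
  exists x; have := le_trans rx (ordW x).
  have [F0 _] := F_folner.
  by rewrite sum_order_empirical// mulrC ler_pM2l// ltr0n cardfs_gt0.
move=> rA.
have /choice[x xP] : forall n, exists x, (exists x,
      r <= -1 + \sum_i empirical T (F n) x [set y | 0 < phi i y]) ->
    r <= -1 + \sum_i empirical T (F n) x [set y | 0 < phi i y].
  move=> n; have [[x rx]|nr] := pselect (exists x,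
      r <= -1 + \sum_i empirical T (F n) x [set y | 0 < phi i y]).
    by exists x.
  by exists x0.
have [||x1 [mu [mu_inv r_mu]]] := @exists_invariant_measure_ge R G X T T_system
  F x #|` fset_set V| C (fun i => nth set0 (fset_set V) i)
  (fun i => [set y | 0 < phi i y]) (r + 1) F_folner.
- move=> i; have [cC CV AC] := phiV i; split => //.
  exact/oV/V_nth.
- by apply: filterS rA => n /xP; rewrite -lerBlDl opprK.
exists x1, mu; split=> //.
by rewrite integral_cover_ord// addeC leeBrDr.
Qed.

End numerable_cover.

Local Open Scope ereal_scope.

Theorem theorem9p1 (R : realType) (G : groupType)
  (G_countable : countable [set: G]) (G_amenable : amenable R G)
  (X : metricType R) (T : G -> X -> X) (T_system : dynamical_system T)
  (F : nat -> {fset G}) (F_folner : folner_sequence R F) :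
  mdim T F <= dyn_dim T.
Proof.
have F_gt0 n : (0 < #|` F n|%:R :> R)%R.
  by rewrite ltr0n cardfs_gt0; have [] := F_folner.
apply: ge_ereal_sup => _ [U covU <-].
have [X_nonempty|X_empty] := pselect ([set: X] !=set0); last first.
  (* On the empty space, set0 is a cover of order -oo. *)
  rewrite (_ : (fun n => _) = cst -oo%E) ?lim_cst ?leNye//.
  apply/funext => n; rewrite (_ : ereal_inf _ = -oo%E).
    by rewrite gt0_muleNy ?lte_fin ?invr_gt0.
  apply/eqP; rewrite -leeNy_eq; apply: ereal_inf_lbound.
  exists set0.
    split; last by move=> A.
    split => //; apply/seteqP; split=> // x; case: X_empty; by exists x.
  rewrite (_ : [set: X] = set0) ?image_set0 ?ereal_sup0//.
  by apply/eqP/negPn/negP => /set0P.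
apply: le_trans (ereal_sup_ubound _); last by exists U.
apply: le_ereal_inf_tmp => _ [V [covV VU] <-].
set s := ereal_sup _.
have s_ge (r : R) : (exists (x0 : X) (mu : probability (borel x0) R),
    T_invariant T mu /\ (r%:E <= \int[mu]_x (cover_ord R V x)%:E)%E) ->
    (r%:E <= s)%E.
  move=> [x0 [mu [mu_inv r_mu]]]; apply: le_trans r_mu _.
  by apply: ereal_sup_ubound; exists x0, mu.
set a := (fun n => _); have [cvga|dvga] := pselect (cvgn a); last first.
  (* The default value of a divergent limit is 0; nonemptiness of X matters here. *)
  rewrite (dvgP dvga); apply: s_ge.
  apply: (exists_invariant_measure_order_ge T_system F_folner) => //.
  apply: nearW => n W covW _; have [x _] := X_nonempty.
  by exists x; rewrite mul0r cover_ord_ge0.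
apply: le_ereal_lt_fin => r r_lt; apply: s_ge.
apply: (exists_invariant_measure_order_ge T_system F_folner) => //.
have r_lt_a : \forall n \near \oo, (r%:E < a n)%E.
  exact: cvga (open_ereal_gt' r_lt).
apply: filterS r_lt_a => n ran W covW WV.
have : (r%:E < (#|` F n|%:R^-1)%:E *
    ereal_sup [set (cover_ord R W x)%:E | x in [set: X]])%E.
  apply: lt_le_trans ran _; rewrite lee_pmul2l//; last by rewrite lte_fin invr_gt0.
  apply: ereal_inf_lbound; exists W => //; split => //.
  exact: refines_trans WV (refines_joined VU).
rewrite muleC lte_pdivlMr//.
move=> /ereal_sup_gt[_ [x _ <-]]; rewrite -EFinM lte_fin => /ltW rx.
by exists x.
Qed.
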